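(* Let $k$ be a field and let $\tilde\Psi$ be an irreducible, reduced root datum carrying an action of $\mathrm{Gal}(k)$. Let $\Psi$ be a maximal $\mathrm{Gal}(k)$-invariant subdatum of $\tilde\Psi$. Then $\Psi$ is either closed or dual-closed in $\tilde\Psi$.
   Context: $\mathrm{Gal}(k)$ is the absolute Galois group of $k$, acting on the root datum by automorphisms (through a finite quotient). A root datum is irreducible if its root system is irreducible. A root datum $\Psi=(X^*,\Phi,X_*,\Phi^\vee)$ is a subdatum of $\tilde\Psi=(X^*,\tilde\Phi,X_*,\tilde\Phi^\vee)$ (same lattices) if $\Phi\subseteq\tilde\Phi$ and each root of $\Phi$ has the same coroot in both data. ''Maximal'' means maximal among proper $\mathrm{Gal}(k)$-invariant subdata. $\Psi$ is closed in $\tilde\Psi$ if $\Phi$ is closed in $\tilde\Phi$ (whenever $\alpha,\beta\in\Phi$ and $\alpha+\beta\in\tilde\Phi$, then $\alpha+\beta\in\Phi$), and dual-closed if $\Phi^\vee$ is closed in $\tilde\Phi^\vee$. *)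

(* Defs.v *)
From HB Require Import structures.
From mathcomp Require Import all_boot all_order all_algebra all_field.
From mathcomp Require Import finmap.

Set Implicit Arguments.
Unset Strict Implicit.
Unset Printing Implicit Defensive.

Import GRing.Theory Num.Theory.
Local Open Scope fset_scope.
Local Open Scope ring_scope.

(** * The absolute Galois group *)

(* Nothing is assumed on the characteristic. Since a separable polynomial is
   nonzero, the first conjunct contains the algebraicity of K over k. *)
Definition separable_closure (k K : fieldType) (iota : {rmorphism k -> K}) :
    Prop :=
  (forall x : K, exists2 p : {poly k},
     separable_poly p & root (map_poly iota p) x) /\
  (forall p : {poly K}, separable_poly p -> (1 < size p)%N ->
     exists x : K, root p x).

(* Gal(K / k); this is Gal(k) when iota : k -> K is a separable closure. *)
Record absGal (k K : fieldType) (iota : {rmorphism k -> K}) := AbsGal {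
  gal_fun :> {rmorphism K -> K};
  gal_bij : bijective gal_fun;
  gal_fix : forall c : k, gal_fun (iota c) = iota c
}.

(** * Root data *)

Definition free_of_finite_rank (X : zmodType) : Prop :=
  exists (n : nat) (f : {additive 'rV[int]_n -> X}), bijective f.

Record dual_lattices := DualLattices {
  chars : zmodType;
  cochars : zmodType;
  pairing : chars -> cochars -> int;
  pairingDl : forall x x' y, pairing (x + x') y = pairing x y + pairing x' y;
  pairingDr : forall x y y', pairing x (y + y') = pairing x y + pairing x y';
  chars_free : free_of_finite_rank chars;
  cochars_free : free_of_finite_rank cochars;
  pairing_perfectl : forall f : {additive chars -> int},
    exists! y : cochars, forall x, f x = pairing x y;
  pairing_perfectr : forall f : {additive cochars -> int},
    exists! x : chars, forall y, f y = pairing x y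
}.

(* A root datum on fixed lattices. The map [coroot] is total for convenience;
   only its values on [roots] are meaningful. Reflections being involutions,
   stability of the roots and of the coroots is stated as an inclusion. *)
Record root_datum (L : dual_lattices) := RootDatum {
  roots : {fset chars L};
  coroot : chars L -> cochars L;
  coroot_inj : {in roots &, injective coroot};
  pairing_coroot : forall a, a \in roots -> pairing a (coroot a) = 2;
  refl_roots : forall a b, a \in roots -> b \in roots ->
    b - a *~ pairing b (coroot a) \in roots;
  refl_coroots : forall a b, a \in roots -> b \in roots ->
    coroot b - coroot a *~ pairing a (coroot b) \in [fset coroot c | c in roots]
}.

Definition coroots (L : dual_lattices) (P : root_datum L) : {fset cochars L} :=
  [fset coroot P a | a in roots P].

(* b is a rational multiple of a when b *~ n = a *~ m with n != 0. *)
Definition rd_reduced (L : dual_lattices) (P : root_datum L) : Prop :=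
  forall (a b : chars L) (m n : int), a \in roots P -> b \in roots P ->
    n != 0 -> b *~ n = a *~ m -> b = a \/ b = - a.

Definition rd_orthogonal (L : dual_lattices) (P : root_datum L)
    (a b : chars L) : Prop :=
  pairing a (coroot P b) = 0 /\ pairing b (coroot P a) = 0.

(* A and B are automatically disjoint: pairing a (coroot a) = 2. *)
Definition rd_irreducible (L : dual_lattices) (P : root_datum L) : Prop :=
  roots P != fset0 /\
  ~ exists A B : {fset chars L},
      [/\ A != fset0, B != fset0, roots P = A `|` B &
          forall a b, a \in A -> b \in B -> rd_orthogonal P a b].

Definition subdatum (L : dual_lattices) (P Q : root_datum L) : Prop :=
  roots P `<=` roots Q /\ {in roots P, coroot P =1 coroot Q}.

Definition proper_subdatum (L : dual_lattices) (P Q : root_datum L) : Prop :=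
  subdatum P Q /\ roots P != roots Q.

Definition closed_in (V : zmodType) (A B : {fset V}) : Prop :=
  forall a b, a \in A -> b \in A -> a + b \in B -> a + b \in A.

Definition rd_closed (L : dual_lattices) (P Q : root_datum L) : Prop :=
  closed_in (roots P) (roots Q).

Definition rd_dual_closed (L : dual_lattices) (P Q : root_datum L) : Prop :=
  closed_in (coroots P) (coroots Q).

(** * Galois actions *)

Definition rd_automorphism (L : dual_lattices) (P : root_datum L)
    (f : {additive chars L -> chars L})
    (g : {additive cochars L -> cochars L}) : Prop :=
  [/\ bijective f, bijective g,
      forall x y, pairing (f x) (g y) = pairing x y,
      [fset f a | a in roots P] = roots P &
      {in roots P, forall a, coroot P (f a) = g (coroot P a)}].

(* [act_finite] says that the kernel of the action is open for the Krull
   topology: it contains the Galois group over some k(s), s finite. It also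
   makes the identity act trivially, and the action depend only on the
   underlying function of an automorphism. *)
Record gal_action (k K : fieldType) (iota : {rmorphism k -> K})
    (L : dual_lattices) (P : root_datum L) := GalAction {
  act : absGal iota -> {additive chars L -> chars L};
  coact : absGal iota -> {additive cochars L -> cochars L};
  act_aut : forall s, rd_automorphism P (act s) (coact s);
  act_comp : forall s t u : absGal iota, u =1 s \o t ->
    act u =1 act s \o act t /\ coact u =1 coact s \o coact t;
  act_finite : exists r : seq K, forall s : absGal iota,
    {in r, forall x, s x = x} -> act s =1 id /\ coact s =1 id
}.

Definition gal_invariant (k K : fieldType) (iota : {rmorphism k -> K})
    (L : dual_lattices) (Q : root_datum L) (rho : gal_action iota Q)
    (P : root_datum L) : Prop :=
  forall s : absGal iota,
    [fset act rho s a | a in roots P] = roots P /\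
    [fset coact rho s y | y in coroots P] = coroots P.

Definition maximal_invariant_subdatum (k K : fieldType)
    (iota : {rmorphism k -> K}) (L : dual_lattices) (Q : root_datum L)
    (rho : gal_action iota Q) (P : root_datum L) : Prop :=
  [/\ proper_subdatum P Q, gal_invariant rho P &
      forall P' : root_datum L, proper_subdatum P' Q -> gal_invariant rho P' ->
        subdatum P P' -> roots P' = roots P].

(* Main.v *)
(* In an irreducible reduced root system with two root lengths of squared ratio
   p, let S be a maximal invariant subsystem. The short roots together with the
   long roots in the orbits of S under the reflections in short roots form an
   invariant subsystem containing S. So S contains all short roots, and is then
   dual-closed, or every long root is in the orbit of a long root of S; dually
   for the other length, S being closed if it contains all long roots. If S is
   not closed, two short roots of S have a long sum c outside S. As c is in the
   orbit of a long root of S, congruences modulo p between Cartan integers force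
   c into S, directly for p = 3 and after using the dual condition for p = 2.
   Everything is phrased with Cartan integers, so that duality is transposition;
   a single root length is the case of an empty set of long roots. *)

From HB Require Import structures.
Require Import Defs.
From mathcomp Require Import all_boot all_order all_algebra all_field.
From mathcomp Require Import finmap.
From mathcomp Require Import zify ring.

Set Implicit Arguments.
Unset Strict Implicit.
Unset Printing Implicit Defensive.

Import Order.TTheory GRing.Theory Num.Theory.
Local Open Scope fset_scope.
Local Open Scope ring_scope.

(** * Root systems with at most two lengths, in Cartan integers *)

(** [n a b] stands for the pairing of [a] with the coroot of [b] and [s a b] for the reflection of
    [b] in [a], so that [s a a] is [-a]. Reducedness is contained in [cartan_big]. *)
Record two_length_system (R : finType) (n : R -> R -> int) (s : R -> R -> R)
    (long : pred R) (p : int) : Prop := TwoLengthSystem {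
  cartan_diag : forall a, n a a = 2;
  cartan_refll : forall a b c, n (s a b) c = n b c - n b a * n a c;
  cartan_reflr : forall a b c, n c (s a b) = n c b - n c a * n a b;
  long_refl : forall a b, long (s a b) = long b;
  cartan_sym : forall a b, long a = long b -> n a b = n b a;
  cartan_ratio : forall a b, ~~ long a -> long b -> n b a = p * n a b;
  cartan_big : forall a b, 4 <= n a b * n b a -> b = a \/ b = s a a;
  ratioP : p = 2 \/ p = 3
}.

Lemma two_length_dual (R : finType) (n : R -> R -> int) s (long : pred R) p :
  two_length_system n s long p ->
  two_length_system (fun a b => n b a) s (predC long) p.
Proof.
case=> H1 H2 H3 H4 H5 H6 H7 H8; split=> //=.
- by move=> a b c; rewrite H3 mulrC.
- by move=> a b c; rewrite H2 mulrC.
- by move=> a b; rewrite H4.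
- by move=> a b /negb_inj ab; rewrite H5.
- by move=> a b /negPn la lb; rewrite H6.
- by move=> a b; rewrite mulrC; apply: H7.
Qed.

(** * Orbits under reflections *)

Section Reach.
Variables (R : finType) (s : R -> R -> R).

Definition refl_stable (S : {set R}) : Prop :=
  forall a b, a \in S -> b \in S -> s a b \in S.

(** When the reflections are involutions, directed paths already give the orbits of the group
    generated by the reflections in [A]; see [reach_sym]. *)
Definition reach (A : pred R) : rel R :=
  connect [rel x y | [exists c, A c && (y == s c x)]].

Lemma reach_refl A x : reach A x x. Proof. exact: connect0. Qed.

Lemma reach1 (A : pred R) c x : A c -> reach A x (s c x).
Proof. by move=> Ac; apply/connect1/existsP; exists c; rewrite Ac eqxx. Qed.

Lemma reach_step (A : pred R) c x y : A c -> reach A x y -> reach A x (s c y).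
Proof. by move=> Ac xy; apply: connect_trans xy (reach1 _ Ac). Qed.

Lemma reach_ind (A : pred R) x (P : R -> Prop) :
  P x -> (forall c y, A c -> reach A x y -> P y -> P (s c y)) ->
  forall y, reach A x y -> P y.
Proof.
move=> Px Ps y /connectP[w]; elim/last_ind: w y => [y _ ->//|w z IH y].
rewrite rcons_path last_rcons => /andP[xw /existsP[c /andP[Ac /eqP zE]]] ->.
rewrite zE; apply: Ps => //; last exact: IH.
by apply/connectP; exists w.
Qed.

End Reach.

(** The carrier has no addition, so [c = a + b] is read off the rows of [n]. With [n] transposed,
    the same formula speaks of sums of coroots. *)
Definition sum_closed (R : finType) (n : R -> R -> int) (S : {set R}) : Prop :=
  forall a b c, a \in S -> b \in S ->
    (forall x, n c x = n a x + n b x) -> c \in S.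

(** * Reflections, lengths and the failure of closedness *)

Section Basic.
Variables (R : finType) (n : R -> R -> int) (s : R -> R -> R).
Variables (long : pred R) (p : int).
Hypothesis RS : two_length_system n s long p.

Let nd := cartan_diag RS.
Let nl := cartan_refll RS.
Let nr := cartan_reflr RS.
Let lr := long_refl RS.
Local Notation opp a := (s a a).

Lemma cartan_oppl a x : n (opp a) x = - n a x.
Proof. by rewrite nl nd; ring. Qed.

Lemma cartan_oppr a x : n x (opp a) = - n x a.
Proof. by rewrite nr nd; ring. Qed.

(** Equal rows give [n a b = n b a = 2], so [b] is [a] or [-a] by [cartan_big], and the sign
    excludes [-a]. Identities between reflections thus become ring identities. *)
Lemma cartan_ext a b : (forall x, n a x = n b x) -> a = b.
Proof.
move=> ab; have ba := ab a; have bb := ab b; rewrite !nd in ba bb.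
case: (cartan_big RS (a := a) (b := b)) => [|//|bE]; first by rewrite bb -ba.
by move: bb; rewrite bE cartan_oppr nd.
Qed.

Lemma refl_invol a x : s a (s a x) = x.
Proof. by apply: cartan_ext => y; rewrite !nl !nd; ring. Qed.

Lemma refl_conj a b x : s a (s b x) = s (s a b) (s a x).
Proof. by apply: cartan_ext => y; rewrite !(nl, nr) !nd; ring. Qed.

Lemma refl_opp a x : s (opp a) x = s a x.
Proof. by apply: cartan_ext => y; rewrite !(nl, nr) !nd; ring. Qed.

Lemma refl_fixed a x : n x a = 0 -> s a x = x.
Proof. by move=> xa; apply: cartan_ext => y; rewrite nl xa; ring. Qed.

Lemma cartan_same_length a b : long a = long b ->
  (b = a \/ b = opp a) \/ [/\ n b a = n a b, -1 <= n a b & n a b <= 1].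
Proof.
move=> ab; have ba := cartan_sym RS ab.
have [big|small] := boolP (4 <= n a b * n b a).
  by left; apply: cartan_big RS _ _ big.
by right; rewrite ba in small *; split=> //; nia.
Qed.

Lemma cartan_short_long a b : ~~ long a -> long b ->
  [/\ n b a = p * n a b, -1 <= n a b & n a b <= 1].
Proof.
move=> sa lb; have ba := cartan_ratio RS sa lb.
have [big|small] := boolP (4 <= n a b * n b a).
  case: (cartan_big RS big) => bE; first by rewrite bE (negPf sa) in lb.
  by rewrite bE lr (negPf sa) in lb.
by rewrite ba in small *; split=> //; case: (ratioP RS) => pE; nia.
Qed.

Lemma cartan_eq0 a b : n a b = 0 -> n b a = 0.
Proof.
move=> ab; have [la|sa] := boolP (long a); have [lb|sb] := boolP (long b).
- by rewrite -(cartan_sym RS) // la lb.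
- have := cartan_ratio RS sb la; rewrite ab; case: (ratioP RS) => ->; lia.
- by rewrite (cartan_ratio RS sa lb) ab mulr0.
- by rewrite -(cartan_sym RS) // (negPf sa) (negPf sb).
Qed.

Lemma reach_sym A x y : reach s A x y -> reach s A y x.
Proof.
have e_sym : symmetric [rel x y | [exists c, A c && (y == s c x)]].
  suff H : forall u v, [exists c, A c && (v == s c u)] ->
      [exists c, A c && (u == s c v)].
    by move=> u v; apply/idP/idP; apply: H.
  move=> u v /existsP[c /andP[Ac /eqP->]]; apply/existsP; exists c.
  by rewrite Ac refl_invol eqxx.
by rewrite /reach (sym_connect_sym e_sym).
Qed.

Lemma reach_conj (A : pred R) g x y : (forall a b, A (s a b) = A b) ->
  reach s A x y -> reach s A (s g x) (s g y).
Proof.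
move=> Ar; elim/reach_ind => [|c z Ac _ IH]; first exact: reach_refl.
by rewrite refl_conj; apply: reach_step => //; rewrite Ar.
Qed.

Lemma reach_long (A : pred R) x y : reach s A x y -> long y = long x.
Proof. by elim/reach_ind => // c z _ _ <-. Qed.

Lemma stableE S a b : refl_stable s S -> a \in S -> (s a b \in S) = (b \in S).
Proof.
move=> S_st aS; apply/idP/idP => [|bS]; last exact: S_st.
by move=> /(S_st _ _ aS); rewrite refl_invol.
Qed.

Lemma opp_notin S a : refl_stable s S -> a \notin S -> opp a \notin S.
Proof.
move=> S_st; apply: contra => aS; have := S_st _ _ aS aS.
by rewrite refl_opp refl_invol.
Qed.

(** If [n a b] or [n b a] were negative, both would be: either one is -1 and [c] is a reflection of
    [a] or [b], or [b = -a] and [c] would vanish. Hence [n c a = 2 + n b a >= 2]. As [c] is outside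
    [S], it is not [a] or [-a], so [n c a * n a c < 4]; this leaves only [n c a = p] and
    [n a c = 1]. The same holds for [b]. *)
Lemma not_closed_sum S a b c : refl_stable s S -> a \in S -> b \in S ->
    (forall x, n c x = n a x + n b x) -> c \notin S ->
  [/\ [/\ ~~ long a, ~~ long b & long c], n a c = 1, n b c = 1,
      n a b = p - 2 & n b a = p - 2].
Proof.
move=> S_st aS bS cE cS.
have nz0 y : ~ (forall x, n y x = 0) by move=> y0; have := y0 y; rewrite nd.
have ab_ge0 : 0 <= n a b.
  have [//|ab_lt0] := boolP (0 <= n a b).
  have abF : n a b <> -1.
    move=> abE; case/negP: cS; suff -> : c = s b a by apply: S_st.
    by apply: cartan_ext => x; rewrite nl abE cE; ring.
  have baF : n b a <> -1.
    move=> baE; case/negP: cS; suff -> : c = s a b by apply: S_st.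
    by apply: cartan_ext => x; rewrite nl baE cE; ring.
  have ba_lt0 : n b a < 0.
    have [la|sa] := boolP (long a); have [lb|sb] := boolP (long b).
    - by rewrite -(cartan_sym RS) ?la ?lb //; lia.
    - by have := cartan_ratio RS sb la; case: (ratioP RS) => ->; lia.
    - by have := cartan_ratio RS sa lb; case: (ratioP RS) => ->; lia.
    - by rewrite -(cartan_sym RS) ?(negPf sa) ?(negPf sb) //; lia.
  have big : 4 <= n a b * n b a by nia.
  case: (cartan_big RS big) => bE; first by move: ab_lt0; rewrite bE nd.
  by case: (nz0 c) => x; rewrite cE bE cartan_oppl; ring.
have ba_ge0 : 0 <= n b a.
  have [la|sa] := boolP (long a); have [lb|sb] := boolP (long b).
  - by rewrite -(cartan_sym RS) ?la ?lb //; lia.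
  - by have := cartan_ratio RS sb la; case: (ratioP RS) => ->; lia.
  - by have := cartan_ratio RS sa lb; case: (ratioP RS) => ->; lia.
  - by rewrite -(cartan_sym RS) ?(negPf sa) ?(negPf sb) //; lia.
have ca : n c a = 2 + n b a by rewrite cE nd.
have cb : n c b = 2 + n a b by rewrite cE nd addrC.
have not_big x : n c x >= 2 -> (x \in S) -> n c x * n x c < 4.
  move=> cx xS; rewrite ltNge; apply/negP => big.
  case: (cartan_big RS big) => xE; first by rewrite -xE xS in cS.
  by move: xS; rewrite xE; apply/negP/opp_notin.
have main x y : x \in S -> n c x = 2 + y -> 0 <= y ->
    [/\ ~~ long x, long c, n x c = 1 & y = p - 2].
  move=> xS cx y0; have := not_big x; rewrite cx => /(_ _ xS) cx4.
  have {}cx4 : (2 + y) * n x c < 4 by apply: cx4; lia.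
  have [lx|sx] := boolP (long x); have [lc|sc] := boolP (long c).
  - have := cartan_sym RS (a := c) (b := x).
    by rewrite lx lc cx => /(_ erefl); nia.
  - have := cartan_ratio RS sc lx; rewrite cx => xc; rewrite xc in cx4.
    by case: (ratioP RS) => pE; rewrite pE in cx4; nia.
  - have [cxp _ xc1] := cartan_short_long sx lc.
    rewrite cx in cxp; case: (ratioP RS) => pE.
      by rewrite pE in cxp *; split=> //; lia.
    by rewrite pE in cxp *; split=> //; lia.
  - have := cartan_sym RS (a := c) (b := x).
    by rewrite (negPf sx) (negPf sc) cx => /(_ erefl); nia.
have [sa lc ac baE] := main _ _ aS ca ba_ge0.
by have [sb _ bc abE] := main _ _ bS cb ab_ge0.
Qed.

Lemma closed_of_long S : refl_stable s S -> (forall x, long x -> x \in S) ->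
  sum_closed n S.
Proof.
move=> S_st longS a b c aS bS cE; apply: contraT => cS.
have [[_ _ lc] _ _ _ _] := not_closed_sum S_st aS bS cE cS.
by rewrite longS in cS.
Qed.

(* Modulo p the class of a long root is constant along orbits under short
   reflections, as the coroots of short roots pair into p Z with long roots. *)
Lemma reach_mod x y z : long x -> long y -> reach s (predC long) y z ->
  exists k, n x z = n x y + p * k.
Proof.
move=> lx ly; elim/reach_ind => [|c w sc yw [k IH]].
  by exists 0; rewrite mulr0 addr0.
have [xc _ _] := cartan_short_long sc lx.
by exists (k - n c x * n c w); rewrite nr xc IH; ring.
Qed.

(** * Saturation of a subsystem under short reflections *)

Definition short_saturation (S : {set R}) : {set R} :=
  [set y | ~~ long y || [exists x in S, long x && reach s (predC long) x y]].

Lemma short_saturation_sub (S : {set R}) : S \subset short_saturation S.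
Proof.
apply/subsetP => x xS; rewrite inE; have [lx|//] := boolP (long x).
by apply/existsP; exists x; rewrite xS lx reach_refl.
Qed.

(** Any reflection maps orbits to orbits, since it preserves lengths; this moves [y] to [y']. A step
    from [z] to [s c z] is absorbed because the reflection in [s c z] is the conjugate by [s c] of
    the reflection in [z]; [y'] must vary in this induction. *)
Lemma reach_refl_refl x x' y y' :
  reach s (predC long) x x' -> reach s (predC long) y y' ->
  reach s (predC long) (s x y) (s x' y').
Proof.
have Ar a b : predC long (s a b) = predC long b by rewrite /= lr.
move=> xx' yy'; apply: connect_trans (reach_conj x Ar yy') _.
elim/reach_ind: xx' y' {yy'} => [|c z sc _ IH] y'; first exact: reach_refl.
have -> : s (s c z) y' = s c (s z (s c y')) by rewrite refl_conj refl_invol.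
apply: reach_step => //; apply: connect_trans (IH _).
by apply: reach_conj => //; apply: reach1.
Qed.

Lemma short_saturation_stable S :
  refl_stable s S -> refl_stable s (short_saturation S).
Proof.
move=> S_st a b; rewrite !inE lr => aS /orP[->//|].
case/existsP=> x /and3P[xS lx xb]; have lb := reach_long xb.
rewrite lb lx /=; move: aS => /orP[sa|/existsP[y /and3P[yS ly ya]]].
  by apply/existsP; exists x; rewrite xS lx /=; apply: reach_step.
apply/existsP; exists (s y x); rewrite S_st // lr lx /=.
exact: reach_refl_refl.
Qed.

Lemma short_saturation_equiv (S : {set R}) (g : R -> R) :
    (forall a b, g (s a b) = s (g a) (g b)) ->
    (forall a, long (g a) = long a) ->
    (forall a, a \in S -> g a \in S) ->
  forall a, a \in short_saturation S -> g a \in short_saturation S.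
Proof.
move=> gs gl gS a; rewrite !inE gl => /orP[->//|/existsP[x /and3P[xS lx xa]]].
apply/orP; right; apply/existsP; exists (g x); rewrite gS // gl lx /=.
elim/reach_ind: xa => [|c y sc _ IH]; first exact: reach_refl.
by rewrite gs; apply: reach_step => //=; rewrite gl.
Qed.

(** * Sums of short roots for ratio 3 *)

(** If [c] is in the orbit of [x], then [n x c] is 2 modulo 3, hence -1. So [n a x + n b x = -1],
    and one summand, say [n a x], is -1. Then [n x a = -3] and [n (s a x) c = -1 + 3 = 2], which
    forces [c] to be [s a x] or its opposite, both in [S]. *)
Lemma ratio3_sum S a b c : p = 3 -> refl_stable s S -> a \in S -> b \in S ->
    (forall x, n c x = n a x + n b x) -> c \notin S ->
  forall x, x \in S -> long x -> ~~ reach s (predC long) x c.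
Proof.
move=> p3 S_st aS bS cE cS x xS lx; apply/negP => xc.
have [[sa sb lc] ac bc ab ba] := not_closed_sum S_st aS bS cE cS.
have xcF : c <> x by move=> cx; rewrite cx xS in cS.
have oppF : c <> opp x by move=> cx; case/negP: cS; rewrite cx; apply: S_st.
case: (@cartan_same_length x c) => [|[]//|[cx x1 x2]]; first by rewrite lx lc.
have [k kE] := reach_mod lx lx xc; rewrite nd p3 in kE.
have xcE : n x c = -1 by move: cx x1 x2 kE; clear; lia.
have cxE : n a x + n b x = -1 by rewrite -cE cx.
have [xaE ax1 ax2] := cartan_short_long sa lx.
have [xbE bx1 bx2] := cartan_short_long sb lx.
have key y : y \in S -> n x y = -3 -> n y c = 1 -> False.
  move=> yS xy yc; case: (@cartan_same_length (s y x) c).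
  - by rewrite lr lx lc.
  - have sS : s y x \in S by apply: S_st.
    by move=> [cs|cs]; case/negP: cS; rewrite cs //; apply: S_st.
  - by rewrite nl xcE xy yc => -[].
rewrite p3 in xaE xbE.
have [ax0|ax0] : n a x = -1 \/ n b x = -1.
  by move: cxE ax1 ax2 bx1 bx2; clear; lia.
by apply: (key a) => //; rewrite xaE ax0.
by apply: (key b) => //; rewrite xbE ax0.
Qed.

(** * Orbits of long roots for ratio 2 *)

(** Here [n (s a x) y = - 2 * n a x * n a y] is 2 or -2, and two roots of the same length with such
    a Cartan integer are equal or opposite. *)
Lemma short_meets_frame a x y : p = 2 -> ~~ long a -> long x -> long y ->
    n x y = 0 -> n a x != 0 -> n a y != 0 ->
  y = s a x \/ y = opp (s a x).
Proof.
move=> p2 sa lx ly xy ax ay.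
have [xaE x1 x2] := cartan_short_long sa lx.
have [_ y1 y2] := cartan_short_long sa ly.
case: (@cartan_same_length (s a x) y) => //; first by rewrite lr lx ly.
by rewrite nl xy xaE p2 => -[_]; nia.
Qed.

(** One reflection is enough up to sign. After [z = s c x], a further reflection in [a] fixes [z],
    or fixes [x] and can be absorbed into [c], or meets both of the orthogonal roots [x] and [z] and
    leads back to [x] or [-x] by [short_meets_frame]. *)
Lemma reach_ortho x y : p = 2 -> long x -> reach s (predC long) x y ->
  [\/ y = x, y = opp x | n x y = 0 /\
     exists2 c, ~~ long c & n c x = 1 /\ y = s c x].
Proof.
move=> p2 lx xy.
suff [->|->|[c sc yE]] :
    [\/ y = x, y = opp x | exists2 c, ~~ long c & y = s c x].
- by constructor 1.
- by constructor 2.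
- have [xcE x1 x2] := cartan_short_long sc lx; rewrite p2 in xcE.
  have [cx0|cx0] := eqVneq (n c x) 0.
    by constructor 1; rewrite yE refl_fixed // xcE cx0.
  constructor 3; split; first by rewrite yE nr nd xcE; nia.
  have [cx1|cx1] := eqVneq (n c x) 1; first by exists c.
  exists (opp c); first by rewrite lr.
  by rewrite refl_opp cartan_oppl; split=> //; lia.
elim/reach_ind: xy => [|a z sa xz IH]; first by constructor 1.
have lz := reach_long xz.
case: IH => [->|->|[c sc zE]].
- by constructor 3; exists a.
- have [xaE x1 x2] := cartan_short_long sa lx.
  rewrite p2 in xaE; have [ax0|ax0] := eqVneq (n a x) 0.
    constructor 2; rewrite refl_fixed // cartan_oppl xaE ax0 mulr0.
    exact: oppr0.
  (* The reflection in [s x a] sends [x] to [s x (s a (opp x))], and [s a (opp x)] is orthogonal to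
     [x], hence fixed by [s x]. *)
  constructor 3; exists (s x a); first by rewrite lr.
  apply: cartan_ext => u; rewrite !(nl, nr) !nd xaE.
  have [->|->] : n a x = 1 \/ n a x = -1 by lia.
    by ring.
  by ring.
- have [ax0|ax0] := eqVneq (n a x) 0.
    constructor 3; exists (s a c); first by rewrite lr.
    rewrite zE refl_conj [s a x]refl_fixed //.
    by rewrite (cartan_ratio RS sa lx) ax0 mulr0.
  have [az0|az0] := eqVneq (n a z) 0.
    constructor 3; exists c => //; rewrite -zE refl_fixed //.
    by rewrite (cartan_ratio RS sa) ?az0 ?mulr0 // lz.
  have [cx0|cx0] := eqVneq (n c x) 0.
    constructor 3; exists a => //; congr (s a _); rewrite zE refl_fixed //.
    by rewrite (cartan_ratio RS sc lx) cx0 mulr0.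
  have xz0 : n x z = 0.
    have [xcE c1 c2] := cartan_short_long sc lx; rewrite p2 in xcE.
    by rewrite zE nr nd xcE; nia.
  case: (@short_meets_frame a x z) => //; first by rewrite lz.
    by move->; rewrite refl_invol; constructor 1.
  by move->; rewrite refl_conj refl_invol; constructor 2.
Qed.

End Basic.

(** * Sums of short roots for ratio 2 *)

Section Ratio2.
Variables (R : finType) (n : R -> R -> int) (s : R -> R -> R) (long : pred R).
Hypothesis RS : two_length_system n s long 2.

Let nd := cartan_diag RS.
Let nl := cartan_refll RS.
Let nr := cartan_reflr RS.
Let lr := long_refl RS.

(* The situation in F_4, with short roots +-e_i +- e_j and long roots +-2e_i and
   +-e_1 +- e_2 +- e_3 +- e_4: a = e_3 + e_4, b = e_3 - e_4, c = 2e_3,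
   c' = 2e_4, and m = 2e_1 is a root of S in the orbit of c. As d = e_1 - e_3
   swaps m and c, it is not in S, but its orbit contains a root e of S, and
   l = e - d is long. A root t of S in the orbit of l maps a or b to a root g
   moving m to m2 = +-2e_2 in S; then e swaps m2 and c' up to sign, so that c'
   is in S. In the other types some step has no solution. *)
Lemma ratio2_sum S a b c : refl_stable s S -> a \in S -> b \in S ->
    (forall x, n c x = n a x + n b x) -> c \notin S ->
    (forall y, long y ->
       exists2 x, x \in S & long x /\ reach s (predC long) x y) ->
    (forall y, ~~ long y ->
       exists2 x, x \in S & ~~ long x /\ reach s (predC (predC long)) x y) ->
  False.
Proof.
move=> S_st aS bS cE cS satS satL.
have [[sa sb lc] ac bc ab ba] := not_closed_sum RS S_st aS bS cE cS.
rewrite subrr in ab ba.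
pose c' := s b c.
have c'E x : n c' x = n a x - n b x by rewrite nl !cE ab nd; ring.
have c'S : c' \notin S by rewrite (stableE RS).
have lc' : long c' by rewrite lr.
have cc' : reach s (predC long) c c' by apply: reach1.
have frame x y : x \in S -> long x -> y \notin S -> reach s (predC long) x y ->
    n x y = 0 /\ exists2 d, ~~ long d & n d x = 1 /\ y = s d x.
  move=> xS lx yS xy; case: (reach_ortho RS _ lx xy) => // yE.
    by rewrite yE xS in yS.
  by rewrite yE S_st in yS.
have frame0 x y : x \in S -> long x -> y \notin S -> reach s (predC long) x y ->
    n x y = 0 /\ n y x = 0.
  move=> xS lx yS xy; have [xy0 _] := frame x y xS lx yS xy.
  by split=> //; apply: cartan_eq0 RS _ _ xy0.
have [m mS [lm mc]] := satS c lc.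
have mc' : reach s (predC long) m c' by apply: connect_trans mc cc'.
have [mc0 [d sd [dm cdE]]] := frame m c mS lm cS mc.
have [_ cm0] := frame0 m c mS lm cS mc.
have [mc'0 c'm0] := frame0 m c' mS lm c'S mc'.
have md : n m d = 2 by have := cartan_ratio RS sd lm; rewrite dm.
have dE x : 2 * n d x = n m x - n c x by rewrite cdE nl md; ring.
have dS : d \notin S by apply: contra cS => dS; rewrite cdE S_st.
have am0 : n a m = 0 by move: (cE m) (c'E m); rewrite cm0 c'm0; clear; lia.
have bm0 : n b m = 0 by move: (cE m); rewrite cm0 am0 add0r.
have [e eS [se ed]] := satL d sd.
(* In the dual system the roles of the lengths are exchanged, so [d] is the image of [e] under one
   reflection in a long root [l]. *)
have [||eE|eE|[]] := reach_ortho (two_length_dual RS) _ _ ed => //.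
- by rewrite eE eS in dS.
- by rewrite eE S_st in dS.
move=> de0 [l /negPn ll [el deE]].
have lE x : n l x = n e x - n d x by rewrite deE nl el; ring.
(* If [e] met both orthogonal long roots, [y] would be [s e x] up to sign and so lie in [S]. *)
have splits x y : x \in S -> long x -> y \notin S -> long y -> n x y = 0 ->
    n e x != 0 -> n e y == 0.
  move=> xS lx yS ly xy ex; apply: contraNT yS => ey.
  case: (short_meets_frame RS _ se lx ly xy ex ey) => // ->.
    exact: S_st.
  by apply/S_st; apply/S_st.
(* From [2d = m - c] and [n d e = 0], the root [e] meets [m] exactly when it meets [c], which
   [splits] forbids. *)
have em0 : n e m = 0.
  have ec : n c e = n m e by move: (dE e); rewrite de0; clear; lia.
  apply/eqP; apply: contraT => em; have := splits m c mS lm cS lc mc0 em.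
  move=> /eqP /(cartan_eq0 RS); rewrite ec => /(cartan_eq0 RS) em0.
  by rewrite em0 eqxx in em.
have [t tS [lt tl]] := satS l ll.
have [k1 k1E] := reach_mod RS lm lt tl.
have tm : n t m = n m t by apply: cartan_sym RS _ _ _; rewrite lt lm.
have ml : n m l = n l m by apply: cartan_sym RS _ _ _; rewrite ll lm.
have lm1 : n l m = -1 by rewrite lE em0 dm.
have [k2 k2E] := reach_mod RS lt lm mc.
have tc : n t c = n c t by apply: cartan_sym RS _ _ _; rewrite lt lc.
(* Since [n l m = -1], the congruences make [n t m] and then [n t c] odd. As [c = a + b], the root
   [t] is not orthogonal to both [a] and [b]. *)
suff key f : f \in S -> ~~ long f -> n f m = 0 -> n f t != 0 -> False.
  have ct := cE t; have [at0|at0] := eqVneq (n a t) 0; last exact: (key a).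
  have [bt0|bt0] := eqVneq (n b t) 0; last exact: (key b).
  rewrite at0 bt0 in ct; move: ct k1E k2E; rewrite ml lm1 tc tm => ->.
  by clear; lia.
move=> fS sf fm ft; pose g := s t f.
have gS : g \in S by apply: S_st.
have sg : ~~ long g by rewrite lr.
have gm : n g m != 0.
  rewrite nl fm sub0r oppr_eq0 mulf_neq0 //.
  by move: k1E; rewrite tm ml lm1; clear; lia.
pose m2 := s g m.
have m2S : m2 \in S by apply: S_st.
have lm2 : long m2 by rewrite lr.
have mm2 : reach s (predC long) m m2 by apply: reach1.
have m2m : reach s (predC long) m2 m by apply: reach_sym RS _ _ _ mm2.
have [mg g1 g2] := cartan_short_long RS sg lm.
have mm20 : n m m2 = 0 by rewrite nr nd mg; move: gm g1 g2; clear; nia.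
have [m2c cm2] := frame0 m2 c m2S lm2 cS (connect_trans m2m mc).
have [m2c' _] := frame0 m2 c' m2S lm2 c'S (connect_trans m2m mc').
have ccE : n c c' = 0.
  have -> : n c c' = n c' c by apply: cartan_sym RS _ _ _; rewrite lc lc'.
  by rewrite c'E ac bc subrr.
have dm2 : n d m2 = 0 by move: (dE m2); rewrite mm20 cm2; clear; lia.
have dc' : n d c' = 0 by move: (dE c'); rewrite mc'0 ccE; clear; lia.
(* [n l m2] and [n l c'] are odd, and they equal [n e m2] and [n e c'] because [d] is orthogonal to
   [m2] and [c']. So [e] meets both, against [splits]. *)
have [k3 k3E] := reach_mod RS ll lm mm2.
have [k4 k4E] := reach_mod RS ll lm mc'.
have lm2E := lE m2; have lc'E := lE c'; rewrite lm1 in k3E k4E.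
have em2 : n e m2 != 0 by move: lm2E k3E; rewrite dm2; clear; lia.
have /eqP := splits m2 c' m2S lm2 c'S lc' m2c' em2.
by move: lc'E k4E; rewrite dc'; clear; lia.
Qed.

End Ratio2.

(** * Maximal invariant subsystems *)

Theorem two_length_maximal (R : finType) (n : R -> R -> int) s (long : pred R) p
    (G : (R -> R) -> Prop) (S : {set R}) :
  two_length_system n s long p ->
  (forall g, G g -> (forall a b, g (s a b) = s (g a) (g b)) /\
                    (forall a, long (g a) = long a)) ->
  refl_stable s S -> (forall g, G g -> forall a, a \in S -> g a \in S) ->
  (forall S' : {set R}, refl_stable s S' ->
     (forall g, G g -> forall a, a \in S' -> g a \in S') ->
     S \subset S' -> S' = S \/ S' = setT) ->
  sum_closed n S \/ sum_closed (fun a b => n b a) S.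
Proof.
move=> RS G_eq S_st S_G S_max; have RSd := two_length_dual RS.
have [satS|satS] : short_saturation s long S = S \/
    short_saturation s long S = setT.
- apply: S_max (short_saturation_sub _ _ _).
    exact: short_saturation_stable RS _ S_st.
  move=> g Gg; have [gs gl] := G_eq g Gg.
  exact: short_saturation_equiv gs gl (S_G g Gg).
- right; apply: (closed_of_long RSd S_st) => x /= sx.
  by rewrite -satS inE sx.
have [satL|satL] : short_saturation s (predC long) S = S \/
    short_saturation s (predC long) S = setT.
- apply: S_max (short_saturation_sub _ _ _).
    exact: short_saturation_stable RSd _ S_st.
  move=> g Gg; have [gs gl] := G_eq g Gg.
  by apply: short_saturation_equiv gs _ (S_G g Gg) => a /=; rewrite gl.
- left; apply: (closed_of_long RS S_st) => x lx.
  by rewrite -satL inE /= lx.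
left=> a b c aS bS cE; apply: contraT => cS; exfalso.
have reachS y : long y ->
    exists2 x, x \in S & long x /\ reach s (predC long) x y.
  move=> ly; have := in_setT y; rewrite -satS inE ly /=.
  by case/existsP=> x /and3P[xS lx xy]; exists x.
have reachL y : ~~ long y ->
    exists2 x, x \in S & ~~ long x /\ reach s (predC (predC long)) x y.
  move=> sy; have := in_setT y; rewrite -satL inE /= sy /=.
  by case/existsP=> x /and3P[xS lx xy]; exists x.
case: (ratioP RS) => pE; rewrite pE in RS.
  by have := ratio2_sum RS S_st aS bS cE cS reachS reachL.
have [[_ _ lc] _ _ _ _] := not_closed_sum RS S_st aS bS cE cS.
have [x xS [lx xc]] := reachS c lc.
by have := ratio3_sum RS erefl S_st aS bS cE cS xS lx; rewrite xc.
Qed.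

(** * The pairing as a family of additive maps *)

Section PairingMorphisms.
Variable L : dual_lattices.

Definition pairl (y : cochars L) (x : chars L) : int := pairing x y.
Definition pairr (x : chars L) (y : cochars L) : int := pairing x y.

Fact pairl_is_zmod y : zmod_morphism (pairl y).
Proof.
by move=> x x'; apply/eqP; rewrite eq_sym subr_eq /pairl -pairingDl subrK.
Qed.
HB.instance Definition _ y :=
  GRing.isZmodMorphism.Build (chars L) int (pairl y) (pairl_is_zmod y).

Fact pairr_is_zmod x : zmod_morphism (pairr x).
Proof.
by move=> y y'; apply/eqP; rewrite eq_sym subr_eq /pairr -pairingDr subrK.
Qed.
HB.instance Definition _ x :=
  GRing.isZmodMorphism.Build (cochars L) int (pairr x) (pairr_is_zmod x).

Lemma pairing_subl (x a : chars L) y (k : int) :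
  pairing (x - a *~ k) y = pairing x y - pairing a y * k.
Proof.
by have := raddfB (pairl y) x (a *~ k); rewrite raddfMz -mulrzr intz.
Qed.

Lemma pairing_subr (x : chars L) y b (k : int) :
  pairing x (y - b *~ k) = pairing x y - pairing x b * k.
Proof.
by have := raddfB (pairr x) y (b *~ k); rewrite raddfMz -mulrzr intz.
Qed.

Lemma pairing0l (y : cochars L) : pairing 0 y = 0.
Proof. exact: raddf0 (pairl y). Qed.

Lemma pairingMzl (x : chars L) y (k : int) :
  pairing (x *~ k) y = pairing x y * k.
Proof.
have := pairing_subl 0 x y (- k); rewrite mulrNz opprK add0r pairing0l => ->.
by ring.
Qed.

Lemma pairing_extr (y y' : cochars L) :
  (forall x : chars L, pairing x y = pairing x y') -> y = y'.
Proof.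
move=> yy'.
have [z [_ z_uniq]] := pairing_perfectl (pairl y : {additive _ -> _}).
by rewrite -(z_uniq y) // -(z_uniq y').
Qed.

End PairingMorphisms.

(** * The invariant form of a root datum and its root lengths *)

Section Form.
Variables (L : dual_lattices) (Q : root_datum L).
Local Notation X := (chars L).
Local Notation Y := (cochars L).
Local Notation R := (Defs.roots Q).
Local Notation cr := (coroot Q).

Definition refl (a x : X) : X := x - a *~ pairing x (cr a).

(** The canonical form invariant under the Weyl group; being integral, it gives integer squared
    lengths. *)
Definition coroot_form (x y : X) : int :=
  \sum_(c : R) pairing x (cr (val c)) * pairing y (cr (val c)).

Lemma formC x y : coroot_form x y = coroot_form y x.
Proof. by apply: eq_bigr => c _; rewrite mulrC. Qed.

Lemma form_subl x a y k :
  coroot_form (x - a *~ k) y = coroot_form x y - coroot_form a y * k.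
Proof.
rewrite /coroot_form mulr_suml -sumrB; apply: eq_bigr => c _.
by rewrite pairing_subl; ring.
Qed.

Lemma formMzl x y k : coroot_form (x *~ k) y = coroot_form x y * k.
Proof.
rewrite /coroot_form mulr_suml; apply: eq_bigr => c _.
by rewrite pairingMzl; ring.
Qed.

Lemma formNl x y : coroot_form (- x) y = - coroot_form x y.
Proof. by rewrite -[- x]/(x *~ (-1)) formMzl mulrN1. Qed.

Lemma form_ge0 x : 0 <= coroot_form x x.
Proof. by apply: sumr_ge0 => c _; rewrite -expr2 sqr_ge0. Qed.

Lemma form_gt0 a : a \in R -> 0 < coroot_form a a.
Proof.
move=> aR; rewrite /coroot_form (bigD1 [` aR]) //= (pairing_coroot aR).
by rewrite ltr_wpDr // sumr_ge0 // => c _; rewrite -expr2 sqr_ge0.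
Qed.

Lemma reflN a : a \in R -> refl a a = - a.
Proof.
move=> aR; rewrite /refl pairing_coroot //.
by rewrite -[a *~ 2]/(a + a) opprD addNKr.
Qed.

(** The reflection moves to the coroot side of the pairing, where it permutes the coroots and so
    only reindexes the sum. *)
Lemma form_refl a x y : a \in R ->
  coroot_form (refl a x) (refl a y) = coroot_form x y.
Proof.
move=> aR; pose r (z : Y) := z - cr a *~ pairing a z.
have /fin_all_exists[t tE] (c : R) : exists d : R, cr (val d) = r (cr (val c)).
  case/imfsetP: (refl_coroots aR (valP c)) => d dR dE.
  by exists [` dR]; rewrite /r dE.
have rK : cancel r r.
  move=> z; rewrite /r pairing_subr (pairing_coroot aR).
  have -> : pairing a z - 2 * pairing a z = - pairing a z by ring.
  by rewrite mulrNz opprK subrK.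
have t_inj : injective t.
  move=> c d cd; apply/val_inj/(coroot_inj (valP c) (valP d))/(can_inj rK).
  by rewrite -!tE cd.
rewrite [RHS](reindex_inj t_inj); apply: eq_bigr => c _.
by rewrite !tE /r /refl !pairing_subl !pairing_subr; congr (_ * _); ring.
Qed.

(** Invariance under the reflection in [a], which negates [a]. *)
Lemma form_pairing a x : a \in R ->
  coroot_form x a * 2 = pairing x (cr a) * coroot_form a a.
Proof.
move=> aR; have := form_refl x a aR.
by rewrite reflN // formC formNl formC /refl form_subl; clear; lia.
Qed.

(** The axioms only say that a reflected coroot is some coroot. It is that of the reflected root
    because, by [form_pairing], the invariant form determines the pairing with a coroot. *)
Lemma pairing_coroot_refl a b x : a \in R -> b \in R ->
  pairing x (cr (refl a b)) = pairing (refl a x) (cr b).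
Proof.
move=> aR bR; have abR : refl a b \in R by apply: refl_roots.
have := form_pairing x abR; rewrite form_refl //.
have reflK : refl a (refl a x) = x.
  rewrite {1}/refl {2}/refl pairing_subl (pairing_coroot aR).
  have -> : pairing x (cr a) - 2 * pairing x (cr a) = - pairing x (cr a).
    by ring.
  by rewrite mulrNz opprK subrK.
rewrite -{1}reflK form_refl // (form_pairing _ bR).
by move=> /(mulIf (lt0r_neq0 (form_gt0 bR))).
Qed.

Lemma coroot_refl a b : a \in R -> b \in R ->
  cr (refl a b) = cr b - cr a *~ pairing a (cr b).
Proof.
move=> aR bR; apply: pairing_extr => x.
by rewrite pairing_coroot_refl // /refl pairing_subl pairing_subr mulrC.
Qed.

(* If the product is 4, the translation by u = 2a - <a,b^>b is the product of
   the two reflections on a + Z u, so that finiteness of R kills u. *)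
Lemma pairing_big a b : rd_reduced Q -> a \in R -> b \in R ->
  4 <= pairing a (cr b) * pairing b (cr a) -> b = a \/ b = - a.
Proof.
move=> red aR bR; set m := pairing a (cr b); set m' := pairing b (cr a) => big.
pose u := a *~ 2 - b *~ m.
have A0 := form_gt0 aR; have B0 := form_gt0 bR.
have abE := form_pairing a bR; have baE := form_pairing b aR.
rewrite -/m -/m' in abE baE; rewrite formC in baE.
(* [coroot_form u u] equals [(4 - m * m') * coroot_form a a] and is nonnegative. *)
have mm' : m * m' = 4.
  have uE y : coroot_form u y = coroot_form a y * 2 - coroot_form b y * m.
    by rewrite /u form_subl formMzl.
  have u0 := form_ge0 u.
  rewrite uE (formC a u) (formC b u) !uE (formC b a) in u0.
  by move: A0 B0 abE baE big u0; clear; nia.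
have ua : pairing u (cr a) = 0.
  rewrite /u pairing_subl pairingMzl (pairing_coroot aR) -/m'.
  by move: mm'; clear; lia.
have ub : pairing u (cr b) = 0.
  by rewrite /u pairing_subl pairingMzl (pairing_coroot bR) -/m mulrC subrr.
have orbit k : a + u *+ k \in R.
  elim: k => [|k IH]; first by rewrite addr0.
  have uk c (y := cr c) : pairing u y = 0 ->
      pairing (a + u *+ k) y = pairing a y.
    move=> uy; have := pairing_subl a u y (- k%:Z).
    by rewrite uy mul0r subr0 mulrNz opprK.
  have -> : a + u *+ k.+1 = a + u *+ k - b *~ m - a *~ (2 - 4).
    have -> : 2 - 4 = - Posz 2 by [].
    by rewrite mulrNz opprK mulrSr addrA /u [_ *~ 2 - _]addrC addrA.
  have := refl_roots aR (refl_roots bR IH).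
  by rewrite pairing_subl !uk // (pairing_coroot aR) -/m -/m' mulrC mm'.
have [i [j [ij ijE]]] : exists i j : nat, (i < j)%N /\ a + u *+ i = a + u *+ j.
  pose f (i : 'I_(#|{: R}|.+1)) : R := [` orbit i].
  have /injectivePn[i [j ij /(congr1 val) /= fij]] : ~~ injectiveb f.
    by apply/injectiveP => /leq_card; rewrite card_ord ltnn.
  by case: (ltngtP i j) => [lt|lt|/val_inj eq]; [exists i, j|exists j, i|
    rewrite eq eqxx in ij].
move/addrI: ijE => ijE.
have uji : u *+ (j - i) = 0 by rewrite (mulrnBr _ (ltnW ij)) ijE subrr.
have ji0 : (j - i)%N != 0 by rewrite subn_eq0 -ltnNge.
apply: (red a b (2 * (j - i)%:Z) (m * (j - i)%:Z)) => //.
  by rewrite mulf_neq0 //; apply/eqP => m0; rewrite m0 mul0r in mm'.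
by apply/eqP; rewrite !mulrzA eq_sym -subr_eq0 -mulrzBl -/u; apply/eqP.
Qed.

Definition root_cartan (a b : R) : int := pairing (val a) (cr (val b)).

Definition root_refl (a b : R) : R := [` refl_roots (valP a) (valP b)].

Definition root_length (a : R) : int := coroot_form (val a) (val a).

Local Notation n := root_cartan.
Local Notation len := root_length.

Lemma root_length_gt0 a : 0 < len a.
Proof. exact: form_gt0 (valP a). Qed.

Lemma root_length_refl a b : len (root_refl a b) = len b.
Proof. exact: form_refl (valP a). Qed.

Lemma cartan_length a b : n a b * len b = n b a * len a.
Proof.
have := form_pairing (val a) (valP b); have := form_pairing (val b) (valP a).
by rewrite formC => <- <-. Qed.

Lemma root_cartan_eq0 a b : n a b = 0 -> n b a = 0.
Proof.
move=> ab; have := cartan_length a b; rewrite ab mul0r => /esym/eqP.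
by rewrite mulf_eq0 (gt_eqF (root_length_gt0 a)) orbF => /eqP.
Qed.

(* The roots not orthogonal to some root of the same length as a form a union of
   components, as reflections preserve lengths. *)
Lemma irreducible_meets_length a b : rd_irreducible Q ->
  exists2 a', len a' = len a & n a' b != 0.
Proof.
case=> _ irr.
pose P x :=
  [forall a' : R, (len a' == len a) ==> (pairing (val a') (cr x) == 0)].
have PP (c : R) : reflect (forall a', len a' = len a -> n a' c = 0) (P (val c)).
  apply: (iffP forallP) => H a'.
    by move=> /eqP a'E; have /eqP := implyP (H a') a'E.
  by apply/implyP => /eqP /H /eqP.
have [Pb|/forallPn[a']] := boolP (P (val b)); last first.
  by rewrite negb_imply => /andP[/eqP a'E a'b]; exists a'.
case: irr; exists [fset x in R | ~~ P x], [fset x in R | P x]; split.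
- apply/fset0Pn; exists (val a); rewrite !inE (valP a) /=.
  by apply/PP => /(_ a erefl); rewrite /n (pairing_coroot (valP a)).
- by apply/fset0Pn; exists (val b); rewrite !inE (valP b).
- by apply/fsetP => x; rewrite !inE -andb_orr orNb andbT.
move=> c d; rewrite !inE => /andP[cR nPc] /andP[dR Pd].
suff cd : n [` cR] [` dR] = 0 by split; last exact: root_cartan_eq0 cd.
have /PP {}Pd : P (val [` dR]) by [].
case/forallPn: nPc => a'; rewrite negb_imply => /andP[/eqP a'E a'c].
have := Pd (root_refl [` cR] a'); rewrite root_length_refl => /(_ a'E).
rewrite /n /= pairing_subl; have := Pd a' a'E; rewrite /n /= => -> /eqP.
by rewrite sub0r oppr_eq0 mulf_eq0 (negPf a'c) orbF => /eqP.
Qed.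

(** [m] and [m'] have the same sign and product less than 4, so up to sign one of them is 1 and the
    other at most 3. *)
Lemma length_ratio (m m' la lb : int) : 0 < la -> 0 < lb -> m != 0 ->
    m * m' < 4 -> m * lb = m' * la ->
  [\/ la = lb, la = 2 * lb \/ la = 3 * lb | lb = 2 * la \/ lb = 3 * la].
Proof.
move=> la0 lb0 m0 mm' E.
wlog m_gt0 : m m' m0 mm' E / 0 < m.
  move=> H; have [m_gt0|m_lt0] := boolP (0 < m); first exact: (H m m').
  by apply: (H (- m) (- m')); rewrite ?oppr_eq0 ?mulrNN ?mulNr ?E //; lia.
have m'_gt0 : 0 < m' by nia.
have m4 : m < 4 by nia.
have m'4 : m' < 4 by nia.
have [m1|[m2|m3]] : m = 1 \/ m = 2 \/ m = 3 by lia.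
- have [m'1|[m'1|m'1]] : m' = 1 \/ m' = 2 \/ m' = 3 by lia.
  + by constructor 1; rewrite m1 m'1 in E; lia.
  + by constructor 3; rewrite m1 m'1 in E; lia.
  + by constructor 3; rewrite m1 m'1 in E; lia.
- have m'1 : m' = 1 by rewrite m2 in mm'; lia.
  by constructor 2; rewrite m2 m'1 in E; lia.
- have m'1 : m' = 1 by rewrite m3 in mm'; lia.
  by constructor 2; rewrite m3 m'1 in E; lia.
Qed.

(** Only lengths matter, so [a] may be replaced by a root of its length not orthogonal to [b]. *)
Lemma irreducible_length_ratio a b : rd_irreducible Q -> rd_reduced Q ->
  [\/ len a = len b, len a = 2 * len b \/ len a = 3 * len b
    | len b = 2 * len a \/ len b = 3 * len a].
Proof.
move=> irr red; have [a' <- a'b] := irreducible_meets_length a b irr.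
have [big|small] := boolP (4 <= n a' b * n b a').
  constructor 1; rewrite /len.
  case: (pairing_big red (valP a') (valP b) big) => ->; first by [].
  by rewrite formNl formC formNl opprK.
apply: (length_ratio (m := n a' b) (m' := n b a')) => //.
- exact: root_length_gt0.
- exact: root_length_gt0.
- by rewrite ltNge.
- exact: cartan_length.
Qed.

(** Long means not of minimal length. The last clause makes every length-preserving map preserve
    [long]. *)
Lemma root_datum_two_length : rd_irreducible Q -> rd_reduced Q ->
  exists (long : pred R) (p : int), two_length_system n root_refl long p /\
    forall a b, len a = len b -> long a = long b.
Proof.
move=> irr red; have [/fset0Pn[x xR] _] := irr.
have [a0 _ a0_min] :=
  arg_minnP (fun a : R => `|len a|%N) (erefl : predT [` xR]).
pose long : pred R := fun a => len a != len a0.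
have a0_gt0 := root_length_gt0 a0.
have a0_le a : len a0 <= len a.
  by have := a0_min a isT; have := root_length_gt0 a; clear -a0_gt0; lia.
have long_ratio a : long a -> len a = 2 * len a0 \/ len a = 3 * len a0.
  move=> la; case: (irreducible_length_ratio a a0 irr red) => // [aE|].
    by rewrite /long aE eqxx in la.
  by have := a0_le a; clear -a0_gt0; lia.
(* Twice and three times the minimum cannot both occur, as 3/2 is not an allowed ratio. Without long
   roots, [p = 2] is a default value. *)
have [p p23 long_len] : exists2 p : int, p = 2 \/ p = 3 &
    forall a, long a -> len a = p * len a0.
  have [/existsP[a1 la1]|/existsPn noL] := boolP [exists a, long a]; last first.
    by exists 2; [left|move=> a la; have := noL a; rewrite la].
  case: (long_ratio a1 la1) => a1E; [exists 2|exists 3]; auto => a la;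
    case: (long_ratio a la) => // aE;
    by have := irreducible_length_ratio a a1 irr red; rewrite a1E aE;
      clear -a0_gt0; case; lia.
exists long, p; split; last by move=> a b ab; rewrite /long ab.
have longE a : len a = (if long a then p else 1) * len a0.
  case: ifP => [/long_len //|]; rewrite mul1r.
  by move=> /negbFE/eqP.
split=> //.
- by move=> a; apply: pairing_coroot (valP a).
- by move=> a b c; rewrite /n /= pairing_subl mulrC.
- move=> a b c; rewrite /n /= -/(refl (val a) (val b)).
  rewrite coroot_refl; try exact: valP.
  exact: pairing_subr.
- by move=> a b; rewrite /long root_length_refl.
- move=> a b ab; have := cartan_length a b; rewrite (longE a) (longE b) ab.
  by apply: mulIf; rewrite -longE (gt_eqF (root_length_gt0 b)).
- move=> a b /negPf sa lb; have := cartan_length a b.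
  rewrite (longE a) (longE b) sa lb mul1r.
  by rewrite mulrA => /(mulIf (lt0r_neq0 a0_gt0)) <-; rewrite mulrC.
move=> a b /(pairing_big red (valP a) (valP b))[ab|ab].
  by left; apply: val_inj.
right; apply: val_inj.
by rewrite ab -(reflN (valP a)).
Qed.

End Form.

Lemma imfset_stable (V : choiceType) (f : V -> V) (A : {fset V}) :
  injective f ->
  (forall a, a \in A -> f a \in A) -> [fset f a | a in A] = A.
Proof.
move=> f_inj fA; apply/eqP; rewrite eqEfcard card_imfset //= leqnn andbT.
by apply/fsubsetP => _ /imfsetP[a aA ->]; apply: fA.
Qed.

(** * Subdata from reflection-stable sets of roots *)

Section Subdata.
Variables (L : dual_lattices) (Q : root_datum L).
Local Notation X := (chars L).
Local Notation R := (Defs.roots Q).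
Local Notation cr := (coroot Q).

Definition root_subset (S : {set R}) : {fset X} :=
  [fset x in R | [exists a in S, val a == x]].

Lemma root_subsetP (S : {set R}) x :
  reflect (exists2 a, a \in S & x = val a) (x \in root_subset S).
Proof.
rewrite !inE; apply: (iffP andP).
  by case=> _ /existsP[a /andP[aS /eqP<-]]; exists a.
case=> a aS ->; split; first exact: valP.
by apply/existsP; exists a; rewrite aS eqxx.
Qed.

Lemma val_root_subset (S : {set R}) (a : R) :
  (val a \in root_subset S) = (a \in S).
Proof.
by apply/root_subsetP/idP => [[b bS /val_inj ->]|aS]; last exists a.
Qed.

Lemma stable_root_datum (S : {set R}) : refl_stable (@root_refl L Q) S ->
  exists P : root_datum L, Defs.roots P = root_subset S /\ coroot P = cr.
Proof.
move=> S_st; pose RS := root_subset S.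
have RSR x : x \in RS -> x \in R by move=> /root_subsetP[a _ ->]; apply: valP.
have inj : {in RS &, injective cr}.
  by move=> x y /RSR xR /RSR yR; apply: coroot_inj.
have pair x : x \in RS -> pairing x (cr x) = 2.
  by move=> /RSR; apply: pairing_coroot.
have stR x y : x \in RS -> y \in RS -> y - x *~ pairing y (cr x) \in RS.
  move=> /root_subsetP[a aS ->] /root_subsetP[b bS ->].
  by apply/root_subsetP; exists (root_refl a b); first exact: S_st.
have stC x y : x \in RS -> y \in RS ->
    cr y - cr x *~ pairing x (cr y) \in [fset cr c | c in RS].
  move=> xS yS; apply/imfsetP; exists (refl Q x y); first exact: stR.
  by rewrite coroot_refl // RSR.
by exists (RootDatum inj pair stR stC).
Qed.

End Subdata.

(** * Passage from Galois-invariant subdata to stable sets of roots *)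

Theorem proposition3p4 (k K : fieldType) (iota : {rmorphism k -> K})
    (K_sep : separable_closure iota)
    (L : dual_lattices) (tPsi : root_datum L) (rho : gal_action iota tPsi)
    (irr : rd_irreducible tPsi) (red : rd_reduced tPsi)
    (Psi : root_datum L)
    (Psi_max : maximal_invariant_subdatum rho Psi) :
  rd_closed Psi tPsi \/ rd_dual_closed Psi tPsi.
Proof.
case: Psi_max => [[[sub_roots sub_coroot] _] Psi_inv Psi_max].
pose R := Defs.roots tPsi.
have PsiR x : x \in Defs.roots Psi -> x \in R by apply: (fsubsetP sub_roots).
pose S : {set R} := [set a | val a \in Defs.roots Psi].
pose G (g : R -> R) := exists t, forall a, val (g a) = act rho t (val a).
have act_root t x : x \in R -> act rho t x \in R.
  have [_ _ _ fR _] := act_aut rho t => xR.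
  by rewrite /R -[X in _ \in X]fR; apply: in_imfset.
have act_inj t : injective (act rho t).
  by have [/bij_inj] := act_aut rho t.
have coact_inj t : injective (coact rho t).
  by have [_ /bij_inj] := act_aut rho t.
have act_cartan t x y : y \in R ->
    pairing (act rho t x) (coroot tPsi (act rho t y)) =
    pairing x (coroot tPsi y).
  by have [_ _ fg _ cE] := act_aut rho t => yR; rewrite cE // fg.
(* An automorphism permutes the roots compatibly with their coroots, so it reindexes the sum
   defining the form and preserves lengths. *)
have act_form t x y :
    coroot_form tPsi (act rho t x) (act rho t y) = coroot_form tPsi x y.
  pose h (a : R) : R := [` act_root t _ (valP a)].
  have h_inj : injective h.
    by move=> a b /(congr1 val)/act_inj/val_inj.
  rewrite /coroot_form (reindex_inj h_inj); apply: eq_bigr => a _.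
  by rewrite !(act_cartan t _ _ (valP a)).
have [long [p [RS long_len]]] := root_datum_two_length irr red.
have S_st : refl_stable (@root_refl L tPsi) S.
  move=> a b; rewrite !inE => aS bS.
  by have := refl_roots aS bS; rewrite sub_coroot.
have Psi_act t x : x \in Defs.roots Psi -> act rho t x \in Defs.roots Psi.
  by move=> xP; have [<- _] := Psi_inv t; apply: in_imfset.
have G_S g : G g -> forall a, a \in S -> g a \in S.
  by case=> t gE a; rewrite !inE gE; apply: Psi_act.
have G_eq g : G g ->
    (forall a b, g (root_refl a b) = root_refl (g a) (g b)) /\
    (forall a, long (g a) = long a).
  case=> t gE; split=> [a b|a].
    apply: val_inj; rewrite gE /= !gE raddfB raddfMz act_cartan //.
    exact: valP.
  by apply: long_len; rewrite /root_length gE act_form.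
(* A stable set other than the whole root system carries a proper invariant subdatum, to which the
   maximality of [Psi] applies. *)
have S_max (S' : {set R}) : refl_stable (@root_refl L tPsi) S' ->
    (forall g, G g -> forall a, a \in S' -> g a \in S') ->
    S \subset S' -> S' = S \/ S' = setT.
  move=> S'_st G_S' /subsetP SS'.
  have [->|S'T] := eqVneq S' setT; [by right | left].
  have [P [PE cPE]] := stable_root_datum S'_st.
  have P_act t x : x \in Defs.roots P -> act rho t x \in Defs.roots P.
    rewrite PE => /root_subsetP[a aS' ->].
    pose h (b : R) : R := [` act_root t _ (valP b)].
    have -> : act rho t (val a) = val (h a) by [].
    by rewrite val_root_subset; apply: G_S' => //; exists t.
  have PR x : x \in Defs.roots P -> x \in R.
    by rewrite PE => /root_subsetP[a _ ->]; apply: valP.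
  suff PS : Defs.roots P = Defs.roots Psi.
    by apply/setP => a; rewrite !inE -PS PE val_root_subset.
  apply: Psi_max.
  - split; first by split; [apply/fsubsetP | move=> x _; rewrite cPE].
    apply: contra S'T => /eqP PQ; apply/eqP/setP => a; rewrite inE.
    by rewrite -val_root_subset -PE PQ; apply: valP.
  - move=> t; split; first exact: imfset_stable (act_inj t) (P_act t).
    apply: imfset_stable (coact_inj t) _ => _ /imfsetP[x xP ->].
    have [_ _ _ _ cE] := act_aut rho t.
    by rewrite cPE -cE ?PR // -cPE; apply/in_imfset/P_act.
  - split; last by move=> x xP; rewrite cPE sub_coroot.
    apply/fsubsetP => x xP; rewrite PE; apply/root_subsetP.
    by exists [` PsiR x xP]; rewrite ?SS' ?inE.
case: (two_length_maximal RS G_eq S_st G_S S_max) => S_cl; [left | right].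
  move=> a b aP bP abR.
  have := S_cl [` PsiR a aP] [` PsiR b bP] [` abR].
  rewrite !inE /=; apply=> // x; exact: pairingDl.
move=> _ _ /imfsetP[a aP ->] /imfsetP[b bP ->] /imfsetP[c cR abE].
have {}S_cl := S_cl [` PsiR a aP] [` PsiR b bP] [` cR].
have cP : c \in Defs.roots Psi.
  move: S_cl; rewrite !inE /=; apply=> // x.
  by rewrite /root_cartan /= -abE pairingDr !sub_coroot.
by rewrite abE -sub_coroot //; apply/in_imfset.
Qed.
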